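(* Consider the sixth-order eigenvalue problem on $[-1,1]$ $$-\frac{\mathrm{d}^6\psi}{\mathrm{d}x^6}=\lambda^6\psi,\qquad \psi(\pm1)=\psi'(\pm1)=\psi^{(5)}(\pm1)=0.$$ Its adjoint problem is the eigenvalue problem $$-\frac{\mathrm{d}^6\phi}{\mathrm{d}x^6}=\lambda^6\phi,\qquad \phi'(\pm1)=\phi''(\pm1)=\phi'''(\pm1)=0.$$
   Context: All functions are real-valued, and $\langle f,g\rangle=\int_{-1}^{1}f(x)g(x)\,\mathrm{d}x$. For a linear differential operator $\mathscr{L}_n=\frac{\mathrm{d}^n}{\mathrm{d}x^n}(\cdot)+p_1(x)\frac{\mathrm{d}^{n-1}}{\mathrm{d}x^{n-1}}(\cdot)+\cdots+p_n(x)\,\cdot$ with smooth real coefficients on a closed interval, the (formal) adjoint is $\mathscr{M}_n=(-1)^n\frac{\mathrm{d}^n}{\mathrm{d}x^n}(\cdot)+(-1)^{n-1}\frac{\mathrm{d}^{n-1}}{\mathrm{d}x^{n-1}}(p_1(x)\,\cdot)+\cdots+p_n(x)\,\cdot$; multiplying $\mathscr{L}_n$ by a real constant multiplies $\mathscr{M}_n$ by the same constant. Here the operator is $\mathscr{L}=-\mathrm{d}^6/\mathrm{d}x^6$, with formal adjoint $\mathscr{M}$. Adjoint problem (in the sense of Birkhoff). Let an eigenvalue problem be given by $\mathscr{L}\psi=\lambda^6\psi$ and six linearly independent linear homogeneous boundary conditions $\mathscr{U}_p(\psi)=0$, $p=1,\dots,6$, where each $\mathscr{U}_p(\psi)$ is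 a linear form in the values $\psi^{(k)}(\pm1)$, $0\le k\le5$. For $\psi,\phi\in C^6[-1,1]$, repeated integration by parts gives $\langle\mathscr{L}\psi,\phi\rangle-\langle\psi,\mathscr{M}\phi\rangle=P(\psi,\phi)\big|_{x=-1}^{x=+1}$, where the right-hand side is a bilinear form in the values of $\psi,\phi$ and their derivatives of order at most $5$ at $x=\pm1$. Complete $\mathscr{U}_1,\dots,\mathscr{U}_6$ to a set $\mathscr{U}_1,\dots,\mathscr{U}_{12}$ of linearly independent linear forms in the values $\psi^{(k)}(\pm1)$, $0\le k\le 5$, and let $\mathscr{V}_1,\dots,\mathscr{V}_{12}$ be the linear forms in the values $\phi^{(k)}(\pm1)$, $0\le k\le5$, determined by $$P(\psi,\phi)\big|_{x=-1}^{x=+1}=\sum_{p=1}^{12}\mathscr{U}_p(\psi)\,\mathscr{V}_{13-p}(\phi).$$ The adjoint problem is $\mathscr{M}\phi=\lambda^6\phi$ together with the boundary conditions $\mathscr{V}_p(\phi)=0$, $p=1,\dots,6$ (the space of $\phi$ satisfying these conditions does not depend on the chosen completion). In particular, $\langle\mathscr{L}\psi,\phi\rangle=\langle\psi,\mathscr{M}\phi\rangle$ whenever $\psi$ satisfies the original boundary conditions and $\phi$ the adjoint ones. *)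

(* Defs.v *)
From HB Require Import structures.
From mathcomp Require Import all_boot all_order all_algebra.
From mathcomp Require Import all_classical all_reals all_analysis.
Set Implicit Arguments.
Unset Strict Implicit.
Unset Printing Implicit Defensive.
Import Order.TTheory GRing.Theory Num.Theory numFieldNormedType.Exports.
Local Open Scope classical_set_scope.
Local Open Scope ring_scope.

Section Definitions.
Variable R : realType.
Implicit Types (f g psi phi : R -> R) (x : R).

Definition I11 : set R := `[-1, 1].

(* Derivatives are taken relative to [-1, 1]: two-sided in the interior and
   one-sided at -1 and 1, so that they depend only on the values on [-1, 1]. *)
Definition slope f x : R -> R := fun y => (f y - f x) / (y - x).

Definition derivI f : R -> R := fun x => lim (slope f x @ within I11 x^').

Definition D (k : nat) f : R -> R := iter k derivI f.

(* f is of class C^n on the closed interval [-1, 1]. *)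
Definition Cn (n : nat) f : Prop :=
  (forall k x, (k < n)%N -> I11 x -> cvg (slope (D k f) x @ within I11 x^'))
  /\ {within I11, continuous (D n f)}.

Definition inner f g : R := \int[lebesgue_measure]_(x in I11) (f x * g x).

(* DiffOp c p stands for c * (d^n + p_1 d^(n-1) + ... + p_n); only the values
   p k with 1 <= k <= n matter. *)
Record diffop (n : nat) := DiffOp { scale : R; coef : nat -> R -> R }.

Definition wf_diffop n (L : diffop n) : Prop :=
  scale L != 0 /\ forall k m, (1 <= k <= n)%N -> Cn m (coef L k).

Definition apply_op n (L : diffop n) f : R -> R := fun x =>
  scale L * (D n f x + \sum_(1 <= k < n.+1) coef L k x * D (n - k) f x).

Definition formal_adjoint n (L : diffop n) f : R -> R := fun x =>
  scale L * ((-1) ^+ n * D n f x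
    + \sum_(1 <= k < n.+1)
        (-1) ^+ (n - k) * D (n - k) (fun y => coef L k y * f y) x).

(* A linear form in the values f^(k)(-1), f^(k)(1), 0 <= k < n, is a row vector
   applied to bvals n f; a family of m such forms is an m-row matrix, and a
   bilinear form in such values is a square matrix. *)
Definition bvals (n : nat) f : 'cV[R]_(n + n) :=
  col_mx (\col_(k < n) D k f (-1)) (\col_(k < n) D k f 1).

Definition bform n m (U : 'M[R]_(m, n + n)) (p : 'I_m) f : R :=
  (U *m bvals n f) p 0.

Definition bilin n (P : 'M[R]_(n + n)) psi phi : R :=
  ((bvals n psi)^T *m P *m bvals n phi) 0 0.

(* The problem op f = ev * f on [-1, 1], with the boundary conditions bc f. *)
Record eigenproblem (n : nat) :=
  EigenProblem { op : diffop n; ev : R; bc : (R -> R) -> Prop }.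

(* U is a family of n linearly independent forms giving the boundary conditions
   of pb, completed by U' to 2n linearly independent forms; P is the boundary
   form of Green's identity; V is the dual family of 2n forms. With indices
   starting from 0, the index 2n+1-p of the 1-based convention is rev_ord p. *)
Definition adjoint_data n (pb : eigenproblem n) (U U' : 'M[R]_(n, n + n))
    (P V : 'M[R]_(n + n)) : Prop :=
  [/\ row_free U /\
        (forall psi, Cn n psi -> bc pb psi <-> forall p, bform U p psi = 0),
      row_free (col_mx U U'),
      (forall psi phi, Cn n psi -> Cn n phi ->
         inner (apply_op (op pb) psi) phi
           - inner psi (formal_adjoint (op pb) phi) = bilin P psi phi)
    & (forall psi phi, Cn n psi -> Cn n phi ->
         bilin P psi phi = \sum_(p < n + n)
           bform (col_mx U U') p psi * bform V (rev_ord p) phi)].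

(* pb' is the adjoint problem of pb: the construction can be carried out, and
   however it is carried out, the resulting problem (the formal adjoint operator,
   the same eigenvalue parameter and the first n forms of V) is pb'. *)
Definition is_adjoint_problem n (pb pb' : eigenproblem n) : Prop :=
  [/\ wf_diffop (op pb),
      exists U U' P V, adjoint_data pb U U' P V
    & forall U U' P V, adjoint_data pb U U' P V ->
      [/\ forall phi x, Cn n phi -> I11 x ->
            formal_adjoint (op pb) phi x = apply_op (op pb') phi x,
          ev pb = ev pb'
        & forall phi, Cn n phi ->
            (forall p : 'I_n, bform V (lshift n p) phi = 0) <-> bc pb' phi]].

(* -d^6/dx^6 *)
Definition neg_d6 : diffop 6 := DiffOp 6 (-1) (fun _ _ => 0).

End Definitions.

(* Main.v *)
(* Integrating by parts six times, the boundary form of Green's identity is the jump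
   between -1 and 1 of
     psi phi^(5) - psi' phi^(4) + psi'' phi''' - psi''' phi'' + psi^(4) phi'
       - psi^(5) phi.
   By Hermite interpolation the boundary values of psi are arbitrary, so phi satisfies
   the adjoint conditions, for any admissible choice of forms, iff the boundary form
   vanishes for all psi satisfying the original ones. For these only the three middle
   terms survive, with psi'', psi''' and psi^(4) free at both endpoints. *)
Require Import Defs.
From mathcomp Require Import all_boot all_order all_algebra.
From mathcomp Require Import all_classical all_reals all_analysis.
From mathcomp Require Import ring lra.
Import Order.TTheory GRing.Theory Num.Theory numFieldNormedType.Exports.
Local Open Scope classical_set_scope.
Local Open Scope ring_scope.

(** * Derivatives relative to [-1, 1] and the fundamental theorem of calculus *)

Section OneSidedDerivative.
Context {R : realType}.
Implicit Types (f g : R -> R) (x l m : R) (n k : nat).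
Local Notation J := (@I11 R).

Definition derivesI f x l := slope f x @ within J x^' --> l.

(** No point of [-1, 1] is isolated in it: a step of length at most 1, to the right if [x <= 0] and
    to the left otherwise, stays inside. Properness makes the limit in [derivI] unique. *)
Lemma within_I11_proper x : J x -> ProperFilter (within J x^').
Proof.
rewrite /I11 /= in_itv /= => /andP[x1 x2].
apply: Build_ProperFilter_ex => P /nbhs_ballP[e /= e0 Pe].
pose h := Num.min (e / 2) 1.
have h0 : 0 < h by rewrite lt_min ltr01 divr_gt0.
have he : h < e by rewrite gt_min ltr_pdivrMr // ltr_pMr // ltr1n.
have h1 : h <= 1 by rewrite ge_min lexx orbT.
case: (leP x 0) => x0; [exists (x + h)|exists (x - h)]; apply: Pe => //=.
- by rewrite /ball /= opprD addrA subrr sub0r normrN gtr0_norm.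
- by apply/eqP; lra.
- by rewrite in_itv /=; lra.
- by rewrite /ball /= opprB addrC subrK gtr0_norm.
- by apply/eqP; lra.
- by rewrite in_itv /=; lra.
Qed.

Lemma near_within_I11 x : \forall y \near within J x^', J y /\ y != x.
Proof.
by rewrite near_withinE near_withinE; apply: filterE => y yx Jy; split.
Qed.

Lemma derivI_eq f x l : J x -> derivesI f x l -> derivI f x = l.
Proof. by move=> Ix fl; have := within_I11_proper x Ix => FF; exact: cvg_lim. Qed.

Lemma eq_derivesI f g x l : J x -> {in J, f =1 g} ->
  derivesI f x l -> derivesI g x l.
Proof.
move=> Ix fg; apply: cvg_trans; apply: near_eq_cvg.
near=> y; have [Jy _] : J y /\ y != x by near: y; exact: near_within_I11.
by rewrite /slope !fg ?inE.
Unshelve. all: by end_near. Qed.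

Lemma derivesI_cvg f x l : derivesI f x l ->
  f @ within J x^' --> f x.
Proof.
move=> fl; have idx : (fun y => y) @ within J x^' --> x.
  by apply: cvg_within_filter; apply: cvg_within_filter; exact: cvg_id.
(* Off [x], [f y] is the slope times [y - x], plus [f x]. *)
have : (slope f x \* (fun y => y - x)) + cst (f x) @ within J x^' -->
    l * (x - x) + f x.
  apply: cvgD; last exact: cvg_cst.
  by apply: cvgM => //; apply: cvgB => //; exact: cvg_cst.
rewrite subrr mulr0 add0r; apply: cvg_trans; apply: near_eq_cvg.
near=> y; rewrite /= /slope !fctE /= divfK ?subrK// subr_eq0.
by have [] : J y /\ y != x by near: y; exact: near_within_I11.
Unshelve. all: by end_near. Qed.

Lemma derivesI_continuous f : (forall x, J x -> exists l, derivesI f x l) ->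
  {within J, continuous f}.
Proof.
move=> df; apply/subspace_continuousP => x Ix.
have [l /derivesI_cvg fx] := df x Ix.
(* The limit is along a punctured filter, so the point [x] itself is handled separately. *)
move=> A Afx; have Ax := nbhs_singleton Afx.
have fA : \forall y \near x, y != x -> J y -> A (f y) := fx _ Afx.
suff : \forall y \near x, J y -> A (f y) by [].
by apply: filterS fA => y yA Jy; have [->//|yx] := eqVneq y x; exact: yA.
Qed.

Lemma derivesIM f g x l m : derivesI f x l -> derivesI g x m ->
  derivesI (f \* g) x (l * g x + f x * m).
Proof.
move=> fl gm; have gx := derivesI_cvg _ _ _ gm.
(* The increment of the product is [(f y - f x) * g y + f x * (g y - g x)]; the limit of [g y] comes
   from continuity. *)
have : (slope f x \* g) + (cst (f x) \* slope g x) @ within J x^' -->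
    l * g x + f x * m.
  by apply: cvgD; apply: cvgM => //; exact: cvg_cst.
apply: cvg_trans; apply: near_eq_cvg; near=> y.
by rewrite !fctE /slope /=; ring.
Unshelve. all: by end_near. Qed.

Lemma derivesIZ c f x l : derivesI f x l -> derivesI (fun y => c * f y) x (c * l).
Proof.
move=> fl; have : cst c \* slope f x @ within J x^' --> c * l.
  by apply: cvgM => //; exact: cvg_cst.
apply: cvg_trans; apply: near_eq_cvg; near=> y.
by rewrite /slope /= /cst; ring.
Unshelve. all: by end_near. Qed.

Lemma derivesI_sum (I : Type) (r : seq I) (F : I -> R -> R) (L : I -> R) x :
  (forall i, derivesI (F i) x (L i)) ->
  derivesI (fun y => \sum_(i <- r) F i y) x (\sum_(i <- r) L i).
Proof.
move=> FL; have : (fun y => \sum_(i <- r) slope (F i) x y) @ within J x^' -->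
    \sum_(i <- r) L i.
  by apply: cvg_big => [|i _]; [exact: add_continuous|exact: FL].
apply: cvg_trans; apply: near_eq_cvg; near=> y.
by rewrite /slope -mulr_suml -sumrB.
Unshelve. all: by end_near. Qed.

Lemma derivesI_is_derive f x l : -1 < x < 1 -> derivesI f x l ->
  is_derive x (1 : R) f l.
Proof.
move=> x11 fl.
(* At an interior point [-1, 1] is a neighbourhood, so restricting the filter to it changes
   nothing. *)
have fx : slope f x @ x^' --> l.
  apply: cvg_trans fl => A; rewrite /= !nbhs_simpl /=.
  have I : \forall y \near x^', J y.
    apply: nbhs_dnbhs; have : x \in `]-1, 1[ by rewrite in_itv.
    move/near_in_itvoo; apply: filterS => y /=.
    by rewrite in_itv /= => /andP[/ltW + /ltW]; rewrite /I11 /= in_itv /= => -> ->.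
  by apply: filterS2 I => y Jy; apply.
(* Translation [y = h + x] turns the slope into the library's difference quotient. *)
have d : h^-1 *: (f (h *: 1 + x) - f x) @[h --> 0^'] --> l.
  move=> A lA; have := fx _ lA; rewrite /= !nbhs_simpl /=.
  move=> /nbhs_ballP[e /= e0 eA]; apply/nbhs_ballP; exists e => //= h he h0.
  have := eA (h + x); rewrite /slope /= addrK /ball /= opprD addrCA subrr addr0.
  rewrite normrN [h *: 1]mulr1 [h^-1 *: _]mulrC; apply.
    by move: he; rewrite /ball /= sub0r normrN.
  by rewrite -subr_eq0 addrK.
by apply: DeriveDef; [apply/cvg_ex; exists l|exact: cvg_lim d].
Qed.

(** One-sided differentiability at the endpoints enters only through continuity of [F] there;
    inside, the derivative is two-sided. *)
Lemma derivesI_ftc F f : (forall x, J x -> derivesI F x (f x)) ->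
  {within J, continuous f} ->
  \int[lebesgue_measure]_(x in J) f x = F 1 - F (-1).
Proof.
move=> dF cf.
have cF : {within J, continuous F}.
  by apply: derivesI_continuous => x /dF; exists (f x).
have lt11 : -1 < 1 :> R by lra.
have [_ Fl Fr] := (continuous_within_itvP _ lt11).1 cF.
have ooI x : x \in `]-1, 1[ -> is_derive x (1 : R) F (f x).
  rewrite in_itv /= => x11; apply: derivesI_is_derive => //; apply: dF.
  by rewrite /I11 /= in_itv /=; lra.
rewrite /Rintegral (@continuous_FTC2 _ f F _ _ lt11 cf) //.
  by split=> // x /ooI[].
by move=> x /ooI[_ Fx]; rewrite derive1E.
Qed.

(** * Functions of class C^n and Green's identity *)

Lemma Cn_derivesI n k f x : Cn n f -> (k < n)%N -> J x ->
  derivesI (D k f) x (D k.+1 f x).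
Proof. by move=> [df _] kn Jx; exact: df. Qed.

Lemma Cn_continuous n k f : Cn n f -> (k <= n)%N -> {within J, continuous (D k f)}.
Proof.
move=> nf; rewrite leq_eqVlt => /predU1P[->|kn]; first exact: nf.2.
by apply: derivesI_continuous => x Jx; exists (D k.+1 f x); exact: Cn_derivesI nf kn Jx.
Qed.

(* The derivative telescopes to f g^(n) - (-1)^n f^(n) g. *)
Definition concomitant n f g : R -> R :=
  fun x => \sum_(k < n) (-1) ^+ k * (D k f x * D (rev_ord k) g x).

Lemma derivesI_concomitant n f g x : Cn n f -> Cn n g -> J x ->
  derivesI (concomitant n f g) x (f x * D n g x - (-1) ^+ n * (D n f x * g x)).
Proof.
move=> nf ng Jx.
(* By the product rule the summand of index [k] has derivative [u k - u k.+1]. *)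
pose u k := (-1) ^+ k * (D k f x * D (n - k) g x).
have -> : f x * D n g x - (-1) ^+ n * (D n f x * g x) =
    \sum_(k < n) ((-1) ^+ k * (D k.+1 f x * D (rev_ord k) g x
                               + D k f x * D (rev_ord k).+1 g x)).
  transitivity (- (u n - u 0)); first by rewrite /u subnn subn0 /=; ring.
  rewrite -telescope_sumr // big_mkord -sumrN; apply: eq_bigr => k _.
  by rewrite /u exprS -(subnSK (ltn_ord k)) /=; ring.
apply: derivesI_sum => k; apply: derivesIZ; apply: derivesIM.
  exact: Cn_derivesI nf (ltn_ord k) Jx.
exact: Cn_derivesI ng (ltn_ord (rev_ord k)) Jx.
Qed.

Lemma within_I11_continuousM f g : {within J, continuous f} ->
  {within J, continuous g} -> {within J, continuous (f \* g)}.
Proof.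
move=> /subspace_continuousP cf /subspace_continuousP cg.
by apply/subspace_continuousP => x Jx; apply: cvgM; [exact: cf|exact: cg].
Qed.

Lemma integrable_I11 f : {within J, continuous f} ->
  lebesgue_measure.-integrable J (EFin \o f).
Proof.
by move=> cf; apply: continuous_compact_integrable => //; exact: segment_compact.
Qed.

Lemma green n f g : Cn n f -> Cn n g ->
  inner f (D n g) - (-1) ^+ n * inner (D n f) g =
  concomitant n f g 1 - concomitant n f g (-1).
Proof.
move=> nf ng.
have c1 : {within J, continuous (f \* D n g)}.
  by apply: within_I11_continuousM; [exact: (Cn_continuous n 0)|exact: ng.2].
have c2 : {within J, continuous (D n f \* g)}.
  by apply: within_I11_continuousM; [exact: nf.2|exact: (Cn_continuous n 0)].
have c3 : {within J, continuous (cst ((-1) ^+ n) \* (D n f \* g))}.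
  apply: within_I11_continuousM => //.
  by apply/subspace_continuousP => x _; exact: cvg_cst.
rewrite -(derivesI_ftc (concomitant n f g)
  (fun x => f x * D n g x - (-1) ^+ n * (D n f x * g x))); last 2 first.
- by move=> x; exact: derivesI_concomitant.
- exact: within_continuousB c1 c3.
rewrite RintegralB; last 3 first.
- exact: measurable_itv.
- exact: integrable_I11 c1.
- exact: integrable_I11 c3.
congr (_ - _); rewrite -RintegralZl //; first exact: measurable_itv.
exact: integrable_I11 c2.
Qed.

(** * Polynomials as smooth functions on [-1, 1] *)

Lemma derivesI_horner (p : {poly R}) x : J x -> derivesI (horner p) x p^`().[x].
Proof.
move=> Jx; have /factor_theorem[q pq] : root (p - p.[x]%:P) x.
  by rewrite /root !hornerE subrr.
have pE : p = q * ('X - x%:P) + p.[x]%:P by rewrite -pq subrK.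
have -> : p^`().[x] = q.[x] by rewrite {1}pE !poly.derivE !hornerE; ring.
have : horner q @ within J x^' --> q.[x].
  by do 2 apply: cvg_within_filter; exact: continuous_horner.
apply: cvg_trans; apply: near_eq_cvg; near=> y.
have yx : y != x by apply: (@proj2 (J y)); near: y; exact: near_within_I11.
rewrite /slope -[p.[y] - p.[x]]/(p.[y] - p.[x]) {1}pE !hornerE addrK mulfK//.
by rewrite subr_eq0.
Unshelve. all: by end_near. Qed.

Lemma D_horner k (p : {poly R}) x : J x -> D k (horner p) x = p^`(k).[x].
Proof.
elim: k x => [//|k IH] x Jx; rewrite [LHS]/(derivI (D k (horner p)) x) derivnS.
(* The induction hypothesis identifies [D k] only on [-1, 1], which is all that the relative
   derivative sees. *)
apply: derivI_eq => //; apply: eq_derivesI (derivesI_horner _ _ Jx) => // y.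
by rewrite inE => /IH.
Qed.

Lemma Cn_horner n (p : {poly R}) : Cn n (horner p).
Proof.
have dp k x : J x -> derivesI (D k (horner p)) x p^`(k.+1).[x].
  move=> Jx; rewrite derivnS; apply: eq_derivesI (derivesI_horner _ _ Jx) => // y.
  by rewrite inE => /D_horner.
split=> [k x _ Jx|]; first by apply/cvg_ex; exists p^`(k.+1).[x]; exact: dp.
by apply: derivesI_continuous => x Jx; exists p^`(n.+1).[x]; exact: dp.
Qed.

End OneSidedDerivative.

(** * Two-point Hermite interpolation *)

Section Interpolation.
Context {R : realType}.
Implicit Types (p : {poly R}) (n : nat).

Lemma exp_XsubC_dvdp n p a :
  (forall k, (k < n)%N -> p^`(k).[a] = 0) -> ('X - a%:P) ^+ n %| p.
Proof.
move=> pa; have -> : p = \sum_(i < size p) p^`N(i).[a] *: ('X - a%:P) ^+ i.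
  (* Taylor's formula at [a], obtained by evaluating [p] at [X] written as [a + (X - a)]; terms of
     index below [n] will vanish, the others are divisible. *)
  rewrite -{1}[p]comp_polyXr /comp_poly -{1}[X in _.[X]](subrK a%:P) addrC.
  rewrite nderiv_taylor; last exact: mulrC.
  rewrite size_map_polyC; apply: eq_bigr => i _.
  by rewrite nderivn_map horner_map /= mul_polyC.
elim/big_ind: _ => [|u v|i _]; [exact: dvdp0|exact: dvdp_add|].
have [in_|ni] := ltnP i n; last by rewrite -mul_polyC dvdp_mull ?dvdp_exp2l.
have /eqP := pa i in_; rewrite nderivn_def hornerMn mulrn_eq0.
by rewrite gtn_eqF ?fact_gt0 //= => /eqP ->; rewrite scale0r dvdp0.
Qed.

(** The coprime polynomials (X + 1)^n and (X - 1)^n both divide [p], so a nonzero [p] would have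
    degree at least 2n. *)
Lemma hermite_eq0 n p : (size p <= n + n)%N ->
  (forall k, (k < n)%N -> p^`(k).[-1] = 0) ->
  (forall k, (k < n)%N -> p^`(k).[1] = 0) -> p = 0.
Proof.
move=> sp pN1 p1; apply: contraTeq sp => p0; rewrite -ltnNge.
have : ('X - (-1)%:P) ^+ n * ('X - 1%:P) ^+ n %| p.
  rewrite Gauss_dvdp ?exp_XsubC_dvdp //.
  apply: coprimep_expl; apply: coprimep_expr; apply: coprimep_XsubC2.
  by apply/eqP; lra.
move=> /dvdp_leq => /(_ p0); apply: leq_trans.
rewrite size_mul ?expf_neq0 ?polyXsubC_eq0 // !size_exp_XsubC.
by rewrite addnS.
Qed.

(** Existence follows from uniqueness: the map from the 2n coefficients to the 2n boundary values
    has a square matrix [A], which is injective by [hermite_eq0], hence invertible. *)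
Lemma bvals_horner_surj n (v : 'cV[R]_(n + n)) :
  exists p : {poly R}, bvals n (horner p) = v.
Proof.
pose ev (j : 'I_(n + n)) p :=
  match fintype.split j with inl k => p^`(k).[-1] | inr k => p^`(k).[1] end.
have bvE p j : bvals n (horner p) j 0 = ev j p.
  rewrite /ev mxE; case: fintype.split => k.
    by rewrite mxE D_horner // /I11 /= in_itv /=; lra.
  by rewrite mxE D_horner // /I11 /= in_itv /=; lra.
pose A := \matrix_(i < n + n, j < n + n) ev j 'X^i.
have evE (u : 'rV_(n + n)) j : ev j (rVpoly u) = (u *m A) 0 j.
  rewrite mxE /rVpoly poly_def /ev.
  under [RHS]eq_bigr do rewrite mxE /ev.
  by case: fintype.split => k; rewrite linear_sum horner_sum; apply: eq_bigr => i _;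
    rewrite linearZ hornerZ valK.
have Afree : row_free A.
  apply: inj_row_free => u uA0; rewrite -[u]rVpolyK.
  rewrite (@hermite_eq0 n (rVpoly u)) ?linear0 // ?size_poly // => k kn.
    by have := evE u (lshift n (Ordinal kn)); rewrite uA0 mxE /ev (unsplitK (inl _)).
  by have := evE u (rshift n (Ordinal kn)); rewrite uA0 mxE /ev (unsplitK (inr _)).
exists (rVpoly (v^T *m invmx A)); apply/colP => j.
by rewrite bvE evE mulmxKV ?mxE // -row_free_unit.
Qed.

End Interpolation.

(** * Adjoint boundary conditions for general forms *)

Section AdjointConditions.
Context {R : realType}.
Implicit Types (f g psi phi : R -> R) (n : nat).

Lemma bform_lshift n (U U' : 'M[R]_(n, n + n)) p psi :
  bform (col_mx U U') (lshift n p) psi = bform U p psi.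
Proof. by rewrite /bform mul_col_mx col_mxEu. Qed.

Lemma bform_sol n (W : 'M[R]_(n + n)) (v : 'cV[R]_(n + n)) : row_free W ->
  exists2 psi, (forall m, Cn m psi) & forall p, bform W p psi = v p 0.
Proof.
rewrite row_free_unit => Wu.
have [q qE] := bvals_horner_surj n (invmx W *m v).
by exists (horner q) => [m|p]; [exact: Cn_horner|rewrite /bform qE mulKVmx].
Qed.

Lemma rev_ord_rshift n (p : 'I_n) : rev_ord (rshift n p) = lshift n (rev_ord p).
Proof. by apply: val_inj => /=; rewrite -addnS subnDl. Qed.

(* The sum of Green's identity pairs the boundary conditions with the last n forms
   of V and the completing forms, whose values are free, with the first n. *)
Lemma adjoint_data_bcP n (pb : eigenproblem R n) U U' P V phi :
  adjoint_data pb U U' P V -> Cn n phi ->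
  (forall p : 'I_n, bform V (lshift n p) phi = 0) <->
  (forall psi, Cn n psi -> bc pb psi -> bilin P psi phi = 0).
Proof.
move=> [[_ bcU] Wfree _ PV] nphi; split=> [V0 psi npsi /(bcU _ npsi) U0|P0 p].
  rewrite (PV _ _ npsi nphi) big_split_ord /= !big1 ?addr0 // => p _.
    by rewrite rev_ord_rshift V0 mulr0.
  by rewrite bform_lshift U0 mul0r.
(* All forms vanish at this [psi] except the completing one paired with form [p] of [V], so the sum
   reduces to the value of that form at [phi]. *)
have [psi npsi psiE] := bform_sol n _ (delta_mx (rshift n (rev_ord p)) 0) Wfree.
rewrite -(P0 psi) //; last first.
  apply/(bcU _ (npsi n)) => q; rewrite -(bform_lshift n _ U') psiE mxE.
  by rewrite eq_lrshift.
rewrite (PV _ _ (npsi n) nphi) (bigD1 (rshift n (rev_ord p))) //= big1.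
  by rewrite psiE mxE !eqxx mul1r addr0 rev_ord_rshift rev_ordK.
by move=> q /negPf qp; rewrite psiE mxE qp mul0r.
Qed.

(** Inserting W^-1 W on the left of [P] gives a pairing of [W] with W^-T P; [V] is the latter with
    its rows reversed. *)
Lemma dual_forms_ex n (W P : 'M[R]_(n + n)) : row_free W ->
  exists V : 'M[R]_(n + n), forall psi phi,
    bilin P psi phi = \sum_(p < n + n) bform W p psi * bform V (rev_ord p) phi.
Proof.
rewrite row_free_unit => Wu.
exists (rowsub (@rev_ord _) ((invmx W)^T *m P)) => psi phi.
transitivity (((W *m bvals n psi)^T *m ((invmx W)^T *m P *m bvals n phi)) 0 0).
  by rewrite /bilin trmx_mul !mulmxA -(mulmxA _ W^T) -trmx_mul mulVmx // trmx1 mulmx1.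
rewrite mxE; apply: eq_bigr => p _; rewrite mxE; congr (_ * _).
by rewrite /bform mul_rowsub_mx [RHS]mxE rev_ordK.
Qed.

Lemma row_free_col_mxl m1 m2 n (A : 'M[R]_(m1, n)) (B : 'M[R]_(m2, n)) :
  row_free (col_mx A B) -> row_free A.
Proof.
move=> AB; apply: inj_row_free => v vA.
have : row_mx v 0 *m col_mx A B = 0 *m col_mx A B.
  by rewrite mul_row_col vA !mul0mx addr0.
by move=> /(row_free_inj AB); rewrite -row_mx0 => /eq_row_mx[].
Qed.

Lemma row_free_rowsub1 m n (s : 'I_m -> 'I_n) : injective s ->
  row_free (rowsub s (1%:M : 'M[R]_n)).
Proof.
move=> s_inj; apply/row_freeP; exists (rowsub s 1%:M)^T.
apply/matrixP => i j; rewrite mul_rowsub_mx mul1mx !mxE (inj_eq s_inj).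
by rewrite eq_sym.
Qed.

(** Matrix of the jump of [concomitant]. The blocks follow [bvals]: the values at -1 come first and
    carry the minus sign. *)
Definition green_mx n : 'M[R]_(n + n) :=
  let Q := \matrix_(i < n, j < n) ((-1) ^+ i *+ (j == rev_ord i)) in
  block_mx (- Q) 0 0 Q.

Lemma bilin_green_mx n psi phi :
  bilin (green_mx n) psi phi = concomitant n psi phi 1 - concomitant n psi phi (-1).
Proof.
rewrite /bilin /green_mx /bvals tr_col_mx mul_row_block mul_row_col.
rewrite !mulmx0 addr0 add0r mulmxN mulNmx mxE addrC [X in _ + X]mxE.
have QE x : ((\col_(k < n) D k psi x)^T *m
    \matrix_(i < n, j < n) ((-1) ^+ i *+ (j == rev_ord i)) *m
    (\col_(k < n) D k phi x)) 0 0 = concomitant n psi phi x.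
  rewrite -mulmxA mxE; apply: eq_bigr => k _; rewrite !mxE (bigD1 (rev_ord k)) //=.
  rewrite big1 ?addr0 => [|j /negPf jk]; last by rewrite mxE jk mul0r.
  by rewrite !mxE eqxx mulr1n; ring.
by rewrite !QE.
Qed.

End AdjointConditions.

(** * The operator -d^6/dx^6 and its boundary conditions *)

Section NegD6.
Context {R : realType}.
Implicit Types (f g psi phi : R -> R).

Lemma interpolation_ex n (a b : nat -> R) :
  exists2 f, (forall m, Cn m f) &
    forall k, (k < n)%N -> D k f (-1) = a k /\ D k f 1 = b k.
Proof.
have [p pE] := bvals_horner_surj n (col_mx (\col_(k < n) a k) (\col_(k < n) b k)).
exists (horner p) => [m|k kn]; first exact: Cn_horner.
have /eq_col_mx[/colP/(_ (Ordinal kn)) + /colP/(_ (Ordinal kn))] := pE.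
by rewrite !mxE.
Qed.

Lemma concomitant6_bc f g x : f x = 0 -> D 1 f x = 0 -> D 5 f x = 0 ->
  concomitant 6 f g x =
  D 2 f x * D 3 g x - D 3 f x * D 2 g x + D 4 f x * D 1 g x.
Proof.
(* Over abstract sequences, since ring unfolds D when it compares its values. *)
have E (a b : nat -> R) : a 0%N = 0 -> a 1%N = 0 -> a 5%N = 0 ->
    \sum_(k < 6) (-1) ^+ k * (a k * b (rev_ord k)) =
    a 2%N * b 3%N - a 3%N * b 2%N + a 4%N * b 1%N.
  by rewrite !big_ord_recl big_ord0 /= /bump /= => -> -> ->; ring.
exact: (E (fun k => D k f x) (fun k => D k g x)).
Qed.

Lemma adjoint_bc6P phi :
  (forall psi, Cn 6 psi ->
     [/\ psi (-1) = 0 /\ psi 1 = 0, D 1 psi (-1) = 0 /\ D 1 psi 1 = 0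
       & D 5 psi (-1) = 0 /\ D 5 psi 1 = 0] ->
     concomitant 6 psi phi 1 - concomitant 6 psi phi (-1) = 0) <->
  [/\ D 1 phi (-1) = 0 /\ D 1 phi 1 = 0, D 2 phi (-1) = 0 /\ D 2 phi 1 = 0
    & D 3 phi (-1) = 0 /\ D 3 phi 1 = 0].
Proof.
split=> [conc0|[[d1 d1'] [d2 d2'] [d3 d3']] psi _]; last first.
  case=> [[p0 p0'] [p1 p1'] [p5 p5']].
  rewrite (concomitant6_bc _ _ _ p0 p1 p5) (concomitant6_bc _ _ _ p0' p1' p5').
  have zero (a b c : R) : a * 0 - b * 0 + c * 0 = 0 by ring.
  by rewrite d1 d1' d2 d2' d3 d3' !zero subr0.
(* The [x]'s and [y]'s stand for the first three derivatives of [phi] at -1 and at 1, the [a]'s and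
   [b]'s for the free values of [psi]; testing on unit vectors kills each coefficient. *)
have lin (x1 x2 x3 y1 y2 y3 : R) :
    (forall a2 a3 a4 b2 b3 b4, b2 * y3 - b3 * y2 + b4 * y1
       - (a2 * x3 - a3 * x2 + a4 * x1) = 0) ->
    [/\ x1 = 0 /\ y1 = 0, x2 = 0 /\ y2 = 0 & x3 = 0 /\ y3 = 0].
  move=> H; have := (H 1 0 0 0 0 0, H 0 1 0 0 0 0, H 0 0 1 0 0 0,
                     H 0 0 0 1 0 0, H 0 0 0 0 1 0, H 0 0 0 0 0 1).
  by case=> [[[[[h1 h2] h3] h4] h5] h6]; split; split; lra.
apply: lin => a2 a3 a4 b2 b3 b4.
(* The lists stop at index 4: the default 0 of [nth] prescribes the vanishing fifth derivative. *)
have [psi npsi psiE] :=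
  interpolation_ex 6 (nth 0 [:: 0; 0; a2; a3; a4]) (nth 0 [:: 0; 0; b2; b3; b4]).
have [p0 p0'] := psiE 0%N isT; have [p1 p1'] := psiE 1%N isT.
have [p2 p2'] := psiE 2%N isT; have [p3 p3'] := psiE 3%N isT.
have [p4 p4'] := psiE 4%N isT; have [p5 p5'] := psiE 5%N isT.
rewrite -(conc0 psi (npsi 6%N)); last by split; split.
rewrite (concomitant6_bc _ _ _ p0 p1 p5) (concomitant6_bc _ _ _ p0' p1' p5').
by rewrite p2 p2' p3 p3' p4 p4'.
Qed.

Lemma innerNl f g : {within @I11 R, continuous f} -> {within @I11 R, continuous g} ->
  inner (fun x => - f x) g = - inner f g.
Proof.
move=> cf cg; have cfg := integrable_I11 _ (within_I11_continuousM _ _ cf cg).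
rewrite /inner -mulN1r -RintegralZl //; last exact: measurable_itv.
by apply: eq_Rintegral => x _; rewrite mulN1r mulNr.
Qed.

Lemma innerC f g : inner f g = inner g f.
Proof. by apply: eq_Rintegral => x _; exact: mulrC. Qed.

(** The lower-order terms of the formal adjoint differentiate [0 * f] for arbitrary [f]; read as the
    zero polynomial, it falls under [D_horner]. *)
Lemma mul0_horner f : (fun x => 0 * f x) = horner (0 : {poly R}).
Proof. by apply/funext => x; rewrite mul0r horner0. Qed.

Lemma apply_neg_d6 f x : apply_op (neg_d6 R) f x = - D 6 f x.
Proof.
by rewrite /apply_op /= big1 => [|k _]; [rewrite addr0 mulN1r|rewrite mul0r].
Qed.

Lemma formal_adjoint_neg_d6 f x : @I11 R x ->
  formal_adjoint (neg_d6 R) f x = - D 6 f x.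
Proof.
move=> Ix; rewrite /formal_adjoint /= mul0_horner big1 => [|k _].
  by rewrite addr0 mulN1r -[6%N]/(3 * 2)%N exprM sqrr_sign mul1r.
by rewrite D_horner // linear0 horner0 mulr0.
Qed.

Lemma green_neg_d6 psi phi : Cn 6 psi -> Cn 6 phi ->
  inner (apply_op (neg_d6 R) psi) phi - inner psi (formal_adjoint (neg_d6 R) phi)
  = concomitant 6 psi phi 1 - concomitant 6 psi phi (-1).
Proof.
move=> npsi nphi.
have c k f : Cn 6 f -> (k <= 6)%N -> {within @I11 R, continuous (D k f)}.
  exact: Cn_continuous.
have -> : inner (apply_op (neg_d6 R) psi) phi = - inner (D 6 psi) phi.
  rewrite -innerNl; [|exact: (c 6%N)|exact: (c 0%N)].
  by apply: eq_Rintegral => x _; rewrite apply_neg_d6.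
have -> : inner psi (formal_adjoint (neg_d6 R) phi) = - inner psi (D 6 phi).
  rewrite innerC [in RHS]innerC -innerNl; [|exact: (c 6%N)|exact: (c 0%N)].
  by apply: eq_Rintegral => x; rewrite inE => Ix; rewrite formal_adjoint_neg_d6.
by rewrite -green //; ring.
Qed.

Lemma bvalsE n f (j : 'I_(n + n)) :
  bvals n f j 0 = if (j < n)%N then D j f (-1) else D (j - n) f 1.
Proof.
rewrite mxE; case: fintype.splitP => k ->; rewrite mxE ?ltn_ord //.
by rewrite addKn.
Qed.

(* Positions, in the 0-based numbering of bvals 6, of psi, psi' and psi^(5) at -1 and
   at 1, followed by the remaining ones. *)
Definition bc_order (i : 'I_(6 + 6)) : 'I_(6 + 6) :=
  inord (nth 0%N [:: 0; 1; 5; 6; 7; 11; 2; 3; 4; 8; 9; 10]%N i).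

Lemma nth_bc_order_lt (i : 'I_(6 + 6)) :
  (nth 0 [:: 0; 1; 5; 6; 7; 11; 2; 3; 4; 8; 9; 10] i < 12)%N.
Proof. by case: i; do 12?case=> //. Qed.

Lemma bc_order_inj : injective bc_order.
Proof.
move=> i j /(congr1 val); rewrite /= !inordK ?nth_bc_order_lt // => /eqP.
by rewrite nth_uniq // => /eqP/val_inj.
Qed.

(** The conditions are the first six rows of the permutation matrix of [bc_order]; its last six rows
    serve as the completion. *)
Lemma bc_formsP psi :
  [/\ psi (-1) = 0 /\ psi 1 = 0, D 1 psi (-1) = 0 /\ D 1 psi 1 = 0
    & D 5 psi (-1) = 0 /\ D 5 psi 1 = 0] <->
  forall p, bform (usubmx (rowsub bc_order 1%:M : 'M[R]_(6 + 6, 6 + 6))) p psi = 0.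
Proof.
have UE p : bform (usubmx (rowsub bc_order 1%:M : 'M[R]_(6 + 6, 6 + 6))) p psi =
    bvals 6 psi (bc_order (lshift 6 p)) 0.
  rewrite -(bform_lshift _ _ (dsubmx (rowsub bc_order 1%:M))) vsubmxK.
  by rewrite /bform mul_rowsub_mx mul1mx mxE.
split=> [[[a0 b0] [a1 b1] [a5 b5]] p|U0].
  rewrite UE bvalsE inordK ?nth_bc_order_lt //.
  by case: p; do 6?case=> //.
have H p := etrans (esym (UE p)) (U0 p).
have := (H (inord 0), H (inord 1), H (inord 2), H (inord 3), H (inord 4), H (inord 5)).
rewrite !bvalsE !inordK ?nth_bc_order_lt //= !inordK //=.
by case=> [[[[[? ?] ?] ?] ?] ?].
Qed.

End NegD6.

Theorem proposition3p4 (R : realType) (lambda : R) :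
  is_adjoint_problem
    (EigenProblem (neg_d6 R) (lambda ^+ 6)
       (fun psi => [/\ psi (-1) = 0 /\ psi 1 = 0,
                       D 1 psi (-1) = 0 /\ D 1 psi 1 = 0
                     & D 5 psi (-1) = 0 /\ D 5 psi 1 = 0]))
    (EigenProblem (neg_d6 R) (lambda ^+ 6)
       (fun phi => [/\ D 1 phi (-1) = 0 /\ D 1 phi 1 = 0,
                       D 2 phi (-1) = 0 /\ D 2 phi 1 = 0
                     & D 3 phi (-1) = 0 /\ D 3 phi 1 = 0])).
Proof.
split.
- split=> [|k m _] /=; first by rewrite oppr_eq0 oner_eq0.
  have -> : (fun=> 0) = horner (0 : {poly R}) by apply/funext => x; rewrite horner0.
  exact: Cn_horner.
- pose W : 'M[R]_(6 + 6, 6 + 6) := rowsub bc_order 1%:M.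
  have Wfree : row_free (col_mx (usubmx W) (dsubmx W)).
    by rewrite vsubmxK; apply: row_free_rowsub1; exact: bc_order_inj.
  have [V VE] := dual_forms_ex _ _ (green_mx 6) Wfree.
  exists (usubmx W), (dsubmx W), (green_mx 6), V; split=> //.
  + by split; [exact: row_free_col_mxl Wfree|move=> psi _; exact: bc_formsP].
  + by move=> psi phi npsi nphi; rewrite bilin_green_mx /= green_neg_d6.
- move=> U U' P V UV; split=> //= [phi x _ Ix|phi nphi].
    by rewrite apply_neg_d6 formal_adjoint_neg_d6.
  apply: iff_trans (adjoint_data_bcP _ _ _ _ _ _ _ UV nphi) _.
  apply: iff_trans _ (adjoint_bc6P phi).
  (* Whatever [P] was chosen, on C^6 functions it agrees with the jump of [concomitant], both being
     the difference in Green's identity. *)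
  have [_ _ greenP _] := UV.
  by split=> H psi npsi /(H _ npsi); rewrite -green_neg_d6 // greenP.
Qed.
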